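(* Let $\mathcal{A}$ be a finite tensor category. Then all left and all right Serre tensor ideals of $\mathcal{A}$ are trivial (that is, equal to $0$ or $\mathcal{A}$). As a consequence, $\mathcal{A}$ is tensor reduced.
   Context: Throughout, $\mathbb{k}$ is an algebraically closed field and all categories are $\mathbb{k}$-linear. A monoidal category is rigid if every object has a left and a right dual. A tensor category is a rigid monoidal abelian category $(\mathcal{C},\otimes,\mathbb{1})$ such that $\otimes$ is bilinear on morphisms and $\mathrm{End}_{\mathcal{C}}(\mathbb{1})\cong\mathbb{k}$. An abelian category is finite if every object has finite length and there are only finitely many isomorphism classes of simple objects. A finite tensor category is a tensor category whose underlying abelian category is finite. A Serre subcategory of an abelian category is a (full, strict) subcategory closed under subobjects, quotients and extensions. A left (resp. right) tensor ideal of a monoidal category $\mathcal{C}$ is a subcategory $\mathcal{I}$ with $Y\otimes X\in\mathcal{I}$ (resp. $X\otimes Y\in\mathcal{I}$) for all $X\in\mathcal{I}$, $Y\in\mathcal{C}$. A left (resp. right) Serre tensor ideal is a Serre subcategory that is a left (resp. right) tensor ideal. A monoidal additive category is tensor reduced if for every object $X$, $X\otimes X=0$ if and only if $X=0$. *)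

(* Defs.v *)
From mathcomp Require Import all_boot all_algebra.

Set Implicit Arguments.
Unset Strict Implicit.
Unset Printing Implicit Defensive.

Import GRing.Theory.
Local Open Scope ring_scope.

Declare Scope cat_scope.
Delimit Scope cat_scope with cat.
Local Open Scope cat_scope.

(* [comp g f] is "g after f". *)
Record linear_category (k : fieldType) := LinearCategory {
  obj :> Type;
  Hom : obj -> obj -> lmodType k;
  idm : forall X, Hom X X;
  comp : forall X Y Z, Hom Y Z -> Hom X Y -> Hom X Z;
  compA : forall W X Y Z (h : Hom Y Z) (g : Hom X Y) (f : Hom W X),
    comp h (comp g f) = comp (comp h g) f;
  comp1m : forall X Y (f : Hom X Y), comp (idm Y) f = f;
  compm1 : forall X Y (f : Hom X Y), comp f (idm X) = f;
  comp_linearr : forall X Y Z (g : Hom Y Z), linear (fun f : Hom X Y => comp g f);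
  comp_linearl : forall X Y Z (f : Hom X Y), linear (fun g : Hom Y Z => comp g f)
}.

Arguments idm {k C} X : rename.
Arguments comp {k C X Y Z} g f : rename.

Notation "g '\after' f" := (comp g f)
  (at level 40, left associativity) : cat_scope.

Section Abelian.
Variables (k : fieldType) (C : linear_category k).
Implicit Types X Y Z : C.

Definition is_iso X Y (f : Hom X Y) : Prop :=
  exists g : Hom Y X, g \after f = idm X /\ f \after g = idm Y.

Definition isomorphic X Y : Prop := exists f : Hom X Y, is_iso f.

Definition mono X Y (f : Hom X Y) : Prop :=
  forall T (u v : Hom T X), f \after u = f \after v -> u = v.

Definition epi X Y (f : Hom X Y) : Prop :=
  forall T (u v : Hom Y T), u \after f = v \after f -> u = v.

(* Initial and terminal: the unique morphism can only be the zero vector. *)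
Definition is_zero X : Prop :=
  (forall Y (f : Hom X Y), f = 0) /\ (forall Y (f : Hom Y X), f = 0).

Definition is_kernel K X Y (i : Hom K X) (f : Hom X Y) : Prop :=
  f \after i = 0 /\
  forall T (t : Hom T X), f \after t = 0 -> exists! u : Hom T K, i \after u = t.

Definition is_cokernel X Y Q (f : Hom X Y) (p : Hom Y Q) : Prop :=
  p \after f = 0 /\
  forall T (t : Hom Y T), t \after f = 0 -> exists! u : Hom Q T, u \after p = t.

Definition short_exact X Y Z (i : Hom X Y) (p : Hom Y Z) : Prop :=
  is_kernel i p /\ is_cokernel i p.

Definition is_biproduct X Y P (i1 : Hom X P) (i2 : Hom Y P)
    (p1 : Hom P X) (p2 : Hom P Y) : Prop :=
  [/\ p1 \after i1 = idm X, p2 \after i2 = idm Y,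
      p2 \after i1 = 0, p1 \after i2 = 0
    & i1 \after p1 + i2 \after p2 = idm P].

Definition additive_category : Prop :=
  (exists Z : C, is_zero Z) /\
  (forall X Y, exists (P : C) (i1 : Hom X P) (i2 : Hom Y P)
     (p1 : Hom P X) (p2 : Hom P Y), is_biproduct i1 i2 p1 p2).

Definition abelian_category : Prop :=
  [/\ additive_category,
      forall X Y (f : Hom X Y), exists (K : C) (i : Hom K X), is_kernel i f,
      forall X Y (f : Hom X Y), exists (Q : C) (p : Hom Y Q), is_cokernel f p,
      forall X Y (f : Hom X Y), mono f ->
        exists (Z : C) (g : Hom Y Z), is_kernel f g
    & forall X Y (f : Hom X Y), epi f ->
        exists (Z : C) (g : Hom Z X), is_cokernel g f].

Definition simple X : Prop :=
  ~ is_zero X /\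
  forall Y (i : Hom Y X), mono i -> is_zero Y \/ is_iso i.

(* Existence of a composition series 0 = X_0 < X_1 < ... < X_n = X with every
   X_{i+1} / X_i simple. *)
Inductive finite_length : C -> Prop :=
| finite_length0 X of is_zero X : finite_length X
| finite_lengthS X Y S (i : Hom X Y) (p : Hom Y S) of
    finite_length X & simple S & short_exact i p : finite_length Y.

Definition finite_category : Prop :=
  (forall X, finite_length X) /\
  exists (n : nat) (S : 'I_n -> C),
    (forall i, simple (S i)) /\
    (forall X, simple X -> exists i, isomorphic X (S i)).

(* A full subcategory is given by its objects.  Nonemptiness is part of the
   notion, so that the subcategory contains the zero objects; strictness is
   closure under the subobjects given by isomorphisms. *)
Definition serre_subcategory (I : C -> Prop) : Prop :=
  [/\ exists X, I X,
      forall X Y (i : Hom X Y), mono i -> I Y -> I X,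
      forall X Y (p : Hom X Y), epi p -> I X -> I Y
    & forall X Y Z (i : Hom X Y) (p : Hom Y Z),
        short_exact i p -> I X -> I Z -> I Y].

Definition trivial_subcategory (I : C -> Prop) : Prop :=
  (forall X, I X <-> is_zero X) \/ (forall X, I X).

End Abelian.

Record monoidal (k : fieldType) (C : linear_category k) := Monoidal {
  tens : C -> C -> C;
  tensm : forall X X' Y Y' : C,
    Hom X X' -> Hom Y Y' -> Hom (tens X Y) (tens X' Y');
  unit_obj : C;
  assoc : forall X Y Z, Hom (tens (tens X Y) Z) (tens X (tens Y Z));
  associnv : forall X Y Z, Hom (tens X (tens Y Z)) (tens (tens X Y) Z);
  lunit : forall X, Hom (tens unit_obj X) X;
  runit : forall X, Hom (tens X unit_obj) X;
  tensm_id : forall X Y, tensm (idm X) (idm Y) = idm (tens X Y);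
  tensm_comp : forall X X' X'' Y Y' Y''
    (f' : Hom X' X'') (f : Hom X X') (g' : Hom Y' Y'') (g : Hom Y Y'),
    tensm (f' \after f) (g' \after g) = tensm f' g' \after tensm f g;
  assocK : forall X Y Z, associnv X Y Z \after assoc X Y Z = idm _;
  associnvK : forall X Y Z, assoc X Y Z \after associnv X Y Z = idm _;
  lunit_iso : forall X, is_iso (lunit X);
  runit_iso : forall X, is_iso (runit X);
  assoc_natural : forall X X' Y Y' Z Z'
    (f : Hom X X') (g : Hom Y Y') (h : Hom Z Z'),
    assoc X' Y' Z' \after tensm (tensm f g) h =
    tensm f (tensm g h) \after assoc X Y Z;
  lunit_natural : forall X Y (f : Hom X Y),
    lunit Y \after tensm (idm unit_obj) f = f \after lunit X;
  runit_natural : forall X Y (f : Hom X Y),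
    runit Y \after tensm f (idm unit_obj) = f \after runit X;
  pentagon : forall W X Y Z,
    assoc W X (tens Y Z) \after assoc (tens W X) Y Z =
    tensm (idm W) (assoc X Y Z) \after assoc W (tens X Y) Z
      \after tensm (assoc W X Y) (idm Z);
  triangle : forall X Y,
    tensm (idm X) (lunit Y) \after assoc X unit_obj Y =
    tensm (runit X) (idm Y)
}.

Section Tensor.
Variables (k : fieldType) (C : linear_category k) (M : monoidal C).
Implicit Types X Y D : C.

Local Notation "X '\ox' Y" := (tens M X Y)
  (at level 38, left associativity) : cat_scope.
Local Notation "f '\oxm' g" := (tensm M f g)
  (at level 38, left associativity) : cat_scope.
Local Notation "\1" := (unit_obj M) (at level 0) : cat_scope.

(* [D] is a left dual of [X]; equivalently [X] is a right dual of [D]. *)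
Definition left_dual D X : Prop :=
  exists (ev : Hom (D \ox X) \1) (coev : Hom \1 (X \ox D)),
    runit M X \after (idm X \oxm ev) \after assoc M X D X
      \after (coev \oxm idm X) = lunit M X /\
    lunit M D \after (ev \oxm idm D) \after associnv M D X D
      \after (idm D \oxm coev) = runit M D.

Definition rigid : Prop :=
  forall X, (exists D, left_dual D X) /\ (exists D, left_dual X D).

Definition bilinear_tensor : Prop :=
  (forall X X' Y Y' (g : Hom Y Y'), linear (fun f : Hom X X' => f \oxm g)) /\
  (forall X X' Y Y' (f : Hom X X'), linear (fun g : Hom Y Y' => f \oxm g)).

(* End(1) is isomorphic to k as a k-algebra. *)
Definition scalar_unit_endomorphisms : Prop :=
  exists phi : {linear k^o -> Hom \1 \1},
    [/\ bijective phi, phi 1 = idm \1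
      & forall a b : k, phi (a * b) = phi a \after phi b].

Definition tensor_category : Prop :=
  [/\ abelian_category C, rigid, bilinear_tensor & scalar_unit_endomorphisms].

Definition finite_tensor_category : Prop :=
  tensor_category /\ finite_category C.

Definition left_tensor_ideal (I : C -> Prop) : Prop :=
  forall X Y, I X -> I (Y \ox X).

Definition right_tensor_ideal (I : C -> Prop) : Prop :=
  forall X Y, I X -> I (X \ox Y).

Definition left_serre_tensor_ideal (I : C -> Prop) : Prop :=
  serre_subcategory I /\ left_tensor_ideal I.

Definition right_serre_tensor_ideal (I : C -> Prop) : Prop :=
  serre_subcategory I /\ right_tensor_ideal I.

Definition tensor_reduced : Prop :=
  forall X, is_zero (X \ox X) <-> is_zero X.

End Tensor.

(* Main.v *)
From mathcomp Require Import all_boot all_algebra.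
From Stdlib Require Import Classical.
Require Import Defs.

(** Everything rests on the simplicity of the unit object [1].

    Given this, let [I] be a left Serre tensor ideal containing [X], and [D] a
    left dual of [X].  Then [D ⊗ X] is in [I], and the evaluation
    [D ⊗ X -> 1] is nonzero as soon as [X] is, because the identity of [X]
    factors through it; being a nonzero morphism to a simple object it is an
    epimorphism.  So [1] is in [I], and so is every [Y ≅ Y ⊗ 1].  Right ideals
    are treated with the other dual ([left_dual_ev], [serre_trivial]).  Dually,
    if [X] is nonzero then a coevaluation [1 -> E ⊗ X] is a monomorphism, and
    tensoring it with [X] embeds [X] in [E ⊗ (X ⊗ X)]; hence [X ⊗ X = 0] forces
    [X = 0] ([finite_tensor_reduced]).

    To see that [1] is simple, let [i : U -> 1] be a simple subobject and [D] a
    left dual of [U] ([simple_subunit_iso]).  The dual [1 -> D] of [i] is an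
    epimorphism ([subunit_dual_epi]), so [U -> U ⊗ D] is one too; its target is
    nonzero and [U] is simple, so it is an isomorphism.  The coevaluation
    [1 -> U ⊗ D] thus gives a nonzero [1 -> U], whose composite with [i] is a
    nonzero endomorphism of [1], that is an invertible scalar.  Hence [i] is a
    split epimorphism.

    The exactness of the tensor product used here, [left_dual_tensr_mono] and
    [left_dual_tensl_epi], comes from duality: tensoring with an object is
    adjoint to tensoring with its dual. *)

Set Implicit Arguments.
Unset Strict Implicit.
Unset Printing Implicit Defensive.

Import GRing.Theory.
Local Open Scope ring_scope.
Local Open Scope cat_scope.

(** * Linear categories *)

Section LinearCategory.
Variables (k : fieldType) (C : linear_category k).
Implicit Types X Y Z : C.

Lemma comp_subr X Y Z (g : Hom Y Z) (u v : Hom X Y) :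
  g \after (u - v) = g \after u - g \after v.
Proof. exact: (zmod_morphism_linear (comp_linearr g)). Qed.

Lemma comp_subl X Y Z (f : Hom X Y) (u v : Hom Y Z) :
  (u - v) \after f = u \after f - v \after f.
Proof. exact: (zmod_morphism_linear (comp_linearl f)). Qed.

Lemma comp0r X Y Z (g : Hom Y Z) : g \after (0 : Hom X Y) = 0.
Proof. by rewrite -(subrr 0) comp_subr subrr. Qed.

Lemma comp0l X Y Z (f : Hom X Y) : (0 : Hom Y Z) \after f = 0.
Proof. by rewrite -(subrr 0) comp_subl subrr. Qed.

Lemma mono_eq0 X Y (f : Hom X Y) :
  mono f <-> forall T (u : Hom T X), f \after u = 0 -> u = 0.
Proof.
split=> [f_mono T u fu0 | f_inj T u v fuv]; first by apply: f_mono; rewrite comp0r.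
by apply/subr0_eq/f_inj; rewrite comp_subr fuv subrr.
Qed.

Lemma epi_eq0 X Y (f : Hom X Y) :
  epi f <-> forall T (u : Hom Y T), u \after f = 0 -> u = 0.
Proof.
split=> [f_epi T u uf0 | f_inj T u v ufv]; first by apply: f_epi; rewrite comp0l.
by apply/subr0_eq/f_inj; rewrite comp_subl ufv subrr.
Qed.

Lemma iso_mono X Y (f : Hom X Y) : is_iso f -> mono f.
Proof. by case=> g [gf _] T u v fuv; rewrite -[u]comp1m -[v]comp1m -gf -!compA fuv. Qed.

Lemma iso_epi X Y (f : Hom X Y) : is_iso f -> epi f.
Proof. by case=> g [_ fg] T u v ufv; rewrite -[u]compm1 -[v]compm1 -fg !compA ufv. Qed.

Lemma mono_comp X Y Z (g : Hom Y Z) (f : Hom X Y) :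
  mono g -> mono f -> mono (g \after f).
Proof. by move=> g_mono f_mono T u v; rewrite -!compA => /g_mono/f_mono. Qed.

Lemma mono_section_iso X Y (f : Hom X Y) (s : Hom Y X) :
  mono f -> f \after s = idm Y -> is_iso f.
Proof.
move=> f_mono fs; exists s; split=> //.
by apply: f_mono; rewrite compA fs comp1m compm1.
Qed.

Lemma epi_comp X Y Z (g : Hom Y Z) (f : Hom X Y) :
  epi g -> epi f -> epi (g \after f).
Proof. by move=> g_epi f_epi T u v; rewrite !compA => /f_epi/g_epi. Qed.

Lemma is_zeroE X : is_zero X <-> idm X = 0.
Proof.
split=> [[X0 _] | id0]; first exact: X0.
by split=> Y f; [rewrite -[f]compm1 id0 comp0r | rewrite -[f]comp1m id0 comp0l].
Qed.

Lemma mono_is_zero X Y (f : Hom X Y) : mono f -> is_zero Y -> is_zero X.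
Proof.
move=> /mono_eq0 f_mono [_ Y0]; apply/is_zeroE/f_mono; exact: Y0.
Qed.

Lemma kernel_mono K X Y (i : Hom K X) (f : Hom X Y) : is_kernel i f -> mono i.
Proof.
move=> [fi0 lift] T u v iuv.
have [|w [_ w_uniq]] := lift T (i \after v); first by rewrite compA fi0 comp0l.
by rewrite -(w_uniq u iuv) -(w_uniq v).
Qed.

Lemma cokernel_epi X Y Q (f : Hom X Y) (p : Hom Y Q) : is_cokernel f p -> epi p.
Proof.
move=> [pf0 factor] T u v upv.
have [|w [_ w_uniq]] := factor T (v \after p); first by rewrite -compA pf0 comp0r.
by rewrite -(w_uniq u upv) -(w_uniq v).
Qed.

End LinearCategory.

(** * Simple objects of abelian categories *)

Section SimpleObjects.
Variables (k : fieldType) (C : linear_category k).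
Implicit Types X Y S : C.

Lemma mono_epi_iso X Y (f : Hom X Y) :
  abelian_category C -> mono f -> epi f -> is_iso f.
Proof.
move=> [_ _ _ mono_kernel _] f_mono /epi_eq0 f_epi.
have [Z [g [gf0 lift]]] := mono_kernel _ _ f f_mono.
have [|s [fs _]] := lift Y (idm Y); first by rewrite compm1; exact: f_epi.
exact: mono_section_iso fs.
Qed.

(** The kernel of [f] is a subobject of [S] other than [S], hence zero. *)
Lemma simple_mono S X (f : Hom S X) :
  abelian_category C -> simple S -> f != 0 -> mono f.
Proof.
move=> [_ kernels _ _ _] [_ S_sub] /eqP f0.
have [K [i iK]] := kernels _ _ f.
have [[_ K0] | /iso_epi/epi_eq0 i_epi] := S_sub _ _ (kernel_mono iK).
  apply/mono_eq0 => T t /(proj2 iK)[u [<- _]]; by rewrite (K0 _ u) comp0r.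
by case: f0; apply: i_epi; case: iK.
Qed.

(** The kernel of the cokernel of [f], that is its image, is a nonzero
    subobject of [S], hence [S] itself. *)
Lemma simple_epi S X (f : Hom X S) :
  abelian_category C -> simple S -> f != 0 -> epi f.
Proof.
move=> [_ kernels cokernels _ _] [_ S_sub] /eqP f0.
have [Q [q qQ]] := cokernels _ _ f; have [K [i iK]] := kernels _ _ q.
have [u [iu _]] := proj2 iK _ f (proj1 qQ).
have [[_ K0] | /iso_epi/epi_eq0 i_epi] := S_sub _ _ (kernel_mono iK).
  by case: f0; rewrite -iu (K0 _ u) comp0r.
have q0 : q = 0 by apply: i_epi; case: iK.
by apply/epi_eq0 => T t /(proj2 qQ)[w [<- _]]; rewrite q0 comp0r.
Qed.

Lemma finite_length_simple_sub X :
  finite_length X -> is_zero X \/ exists S (i : Hom S X), simple S /\ mono i.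
Proof.
elim=> {X} [X X0 | X Y S i p _ IH S_simple [iK pQ]]; first by left.
right; case: IH => [[X0 _] | [T [j [T_simple j_mono]]]]; last first.
  by exists T, (i \after j); split; last exact: mono_comp (kernel_mono iK) j_mono.
(* [p] is the cokernel of a zero morphism, hence an isomorphism. *)
have [|s [sp _]] := proj2 pQ Y (idm Y); first by rewrite comp1m; exact: X0.
exists S, s; split=> //; apply: iso_mono; exists p; split=> //.
by apply: (cokernel_epi pQ); rewrite -compA sp comp1m compm1.
Qed.

End SimpleObjects.

(** * Coherence in monoidal categories *)

Section MonoidalCategory.
Variables (k : fieldType) (C : linear_category k) (M : monoidal C).
Implicit Types X Y Z D U : C.

Local Notation "X '\ox' Y" := (tens M X Y)
  (at level 38, left associativity) : cat_scope.
Local Notation "f '\oxm' g" := (tensm M f g)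
  (at level 38, left associativity) : cat_scope.
Local Notation "\1" := (unit_obj M) (at level 0) : cat_scope.

Lemma tensl_comp X Y Y' Y'' (g : Hom Y' Y'') (f : Hom Y Y') :
  idm X \oxm (g \after f) = (idm X \oxm g) \after (idm X \oxm f).
Proof. by rewrite -tensm_comp comp1m. Qed.

Lemma tensr_comp X Y Y' Y'' (g : Hom Y' Y'') (f : Hom Y Y') :
  (g \after f) \oxm idm X = (g \oxm idm X) \after (f \oxm idm X).
Proof. by rewrite -tensm_comp comp1m. Qed.

Lemma tens_interchange X X' Y Y' (f : Hom X X') (g : Hom Y Y') :
  (f \oxm idm Y') \after (idm X \oxm g) = (idm X' \oxm g) \after (f \oxm idm Y).
Proof. by rewrite -!tensm_comp !comp1m !compm1. Qed.

(** Composites are kept nested to the right in the diagram chases below; this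
    turns an equation between composites into a rewrite rule for the head of a
    longer one. *)
Lemma comp_tail W X Y Z (g : Hom Y Z) (f : Hom X Y) (h : Hom X Z) :
  g \after f = h -> forall t : Hom W X, g \after (f \after t) = h \after t.
Proof. by move=> <- t; rewrite compA. Qed.

Lemma assoc_iso X Y Z : is_iso (assoc M X Y Z).
Proof. by exists (associnv M X Y Z); rewrite assocK associnvK. Qed.

Lemma pentagonr W X Y Z :
  (idm W \oxm assoc M X Y Z) \after
    (assoc M W (X \ox Y) Z \after (assoc M W X Y \oxm idm Z)) =
  assoc M W X (Y \ox Z) \after assoc M (W \ox X) Y Z.
Proof. by rewrite pentagon compA. Qed.

Lemma tensl_iso X Y Z (f : Hom Y Z) : is_iso f -> is_iso (idm X \oxm f).
Proof.
by case=> g [gf fg]; exists (idm X \oxm g); rewrite -!tensl_comp gf fg !tensm_id.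
Qed.

Lemma tensr_iso X Y Z (f : Hom Y Z) : is_iso f -> is_iso (f \oxm idm X).
Proof.
by case=> g [gf fg]; exists (g \oxm idm X); rewrite -!tensr_comp gf fg !tensm_id.
Qed.

Lemma tens1l_inj X Y (f g : Hom X Y) : idm \1 \oxm f = idm \1 \oxm g -> f = g.
Proof.
move=> fg; apply: (iso_epi (lunit_iso M X)).
by rewrite -!lunit_natural fg.
Qed.

Lemma tens1r_inj X Y (f g : Hom X Y) : f \oxm idm \1 = g \oxm idm \1 -> f = g.
Proof.
move=> fg; apply: (iso_epi (runit_iso M X)).
by rewrite -!runit_natural fg.
Qed.

(** Kelly's coherence law: tensored on the left with the unit, which loses
    nothing, it follows from the pentagon and two instances of the triangle. *)
Lemma lunit_tens X Y :
  lunit M (X \ox Y) \after assoc M \1 X Y = lunit M X \oxm idm Y.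
Proof.
apply: tens1l_inj.
apply: (iso_epi (assoc_iso \1 (\1 \ox X) Y)).
apply: (iso_epi (tensr_iso Y (assoc_iso \1 \1 X))).
rewrite -assoc_natural -[RHS]compA -tensr_comp triangle.
rewrite tensl_comp -!compA pentagonr.
by rewrite compA triangle -tensm_id assoc_natural.
Qed.

(** * Exactness of tensoring with a dualizable object *)

Section Bilinear.
Hypothesis tens_bilinear : bilinear_tensor M.

Lemma tens0l X X' Y Y' (g : Hom Y Y') : (0 : Hom X X') \oxm g = 0.
Proof.
by rewrite -(subrr 0) (zmod_morphism_linear (proj1 tens_bilinear X X' _ _ g)) subrr.
Qed.

Lemma tens0r X X' Y Y' (f : Hom X X') : f \oxm (0 : Hom Y Y') = 0.
Proof.
by rewrite -(subrr 0) (zmod_morphism_linear (proj2 tens_bilinear _ _ Y Y' f)) subrr.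
Qed.

Lemma tens_is_zerol X Y : is_zero X -> is_zero (X \ox Y).
Proof. by move=> /is_zeroE X0; apply/is_zeroE; rewrite -tensm_id X0 tens0l. Qed.

Lemma tens_is_zeror X Y : is_zero Y -> is_zero (X \ox Y).
Proof. by move=> /is_zeroE Y0; apply/is_zeroE; rewrite -tensm_id Y0 tens0r. Qed.

(** On the right, tensoring with [D] is right adjoint to tensoring with [X], and
    right adjoints preserve monomorphisms: if [f] tensored with [D] kills [u],
    then [f] kills the transpose of [u], and a zigzag identity recovers [u] from
    its transpose. *)
Lemma left_dual_tensr_mono D X A B (f : Hom A B) :
  left_dual M D X -> mono f -> mono (f \oxm idm D).
Proof.
move=> [ev [coev [_ zigzag]]] /mono_eq0 f_mono; apply/mono_eq0 => S u fu0.
(* Up to a unit constraint, [w] is the transpose of [u]. *)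
pose w := (idm A \oxm ev) \after (assoc M A D X \after (u \oxm idm X)).
have w0 : w = 0.
  apply: (iso_mono (runit_iso M A)); rewrite comp0r; apply: f_mono.
  rewrite compA -runit_natural -compA /w.
  rewrite (comp_tail (tens_interchange _ _)) -compA -tensm_id.
  rewrite (comp_tail (esym (assoc_natural _ _ _ _))) -compA -tensr_comp fu0.
  by rewrite tens0l !comp0r.
suff : u \oxm idm \1 = 0 by rewrite -(tens0l _ _ (idm \1)); exact: tens1r_inj.
apply: (iso_mono (assoc_iso A D \1)).
apply: (iso_mono (tensl_iso A (runit_iso M D))).
transitivity ((idm A \oxm lunit M D) \after (assoc M A \1 D \after ((w \oxm idm D)
  \after (associnv M S X D \after (idm S \oxm coev))))); last first.
  by rewrite w0 tens0l !(comp0l, comp0r).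
rewrite -zigzag !tensl_comp -!compA; congr (_ \after _).
rewrite /w !tensr_comp -!compA.
rewrite (comp_tail (assoc_natural _ _ _ _)) -!compA; congr (_ \after _).
apply: (iso_mono (tensl_iso A (assoc_iso D X D))).
rewrite (comp_tail (esym (tensl_comp _ _ _))) associnvK tensm_id comp1m.
rewrite (comp_tail (esym (assoc_natural _ _ _ _))) tensm_id -compA.
rewrite [RHS]compA [RHS]compA -pentagon -!compA; congr (_ \after _).
rewrite (comp_tail (assoc_natural _ _ _ _)) tensm_id -compA.
by rewrite (comp_tail (associnvK _ _ _ _)) comp1m tens_interchange.
Qed.

(** On the left, tensoring with [D] is left adjoint to tensoring with [X], and
    left adjoints preserve epimorphisms.  Recovering [v] from its transpose
    moves a left unit constraint past [B], which is Kelly's law. *)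
Lemma left_dual_tensl_epi X D A B (f : Hom A B) :
  left_dual M D X -> epi f -> epi (idm D \oxm f).
Proof.
move=> [ev [coev [_ zigzag]]] /epi_eq0 f_epi; apply/epi_eq0 => T v vf0.
(* Up to a unit constraint, [w] is the transpose of [v]. *)
pose w := (idm X \oxm v) \after (assoc M X D B \after (coev \oxm idm B)).
have w0 : w = 0.
  have [l [lK _]] := lunit_iso M B.
  suff wl0 : w \after l = 0 by rewrite -[w]compm1 -lK compA wl0 comp0l.
  apply: f_epi; apply: (iso_epi (lunit_iso M A)).
  rewrite comp0l -!compA -lunit_natural (comp_tail lK) comp1m /w.
  rewrite tens_interchange -tensm_id (comp_tail (assoc_natural _ _ _ _)) -compA.
  by rewrite (comp_tail (esym (tensl_comp _ _ _))) vf0 tens0r comp0l.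
apply: (iso_epi (tensr_iso B (runit_iso M D))).
rewrite comp0l -zigzag !tensr_comp -!compA -lunit_tens -compA.
rewrite (comp_tail (assoc_natural _ _ _ _)) -!compA.
rewrite (comp_tail (esym (lunit_natural _ _))) -compA.
rewrite tensm_id (comp_tail (esym (tens_interchange _ _))) -compA.
transitivity (lunit M T \after ((ev \oxm idm T) \after (associnv M D X T \after
  ((idm D \oxm w) \after assoc M D \1 B)))); last first.
  by rewrite w0 tens0r !(comp0l, comp0r).
congr (_ \after (_ \after _)); apply: (iso_mono (assoc_iso D X T)).
rewrite [RHS](comp_tail (associnvK _ _ _ _)) comp1m.
rewrite -tensm_id (comp_tail (assoc_natural _ _ _ _)) -compA.
rewrite /w !tensl_comp -!compA -assoc_natural; congr (_ \after _).
rewrite (comp_tail (pentagon _ _ _ _ _)) -!compA; congr (_ \after (_ \after _)).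
by rewrite (comp_tail (esym (tensr_comp _ _ _))) associnvK tensm_id comp1m.
Qed.

(** The zigzag identities factor the identities of [D] and [X] through
    morphisms induced by the evaluation. *)
Lemma left_dual_ev D X :
  left_dual M D X ->
  (exists ev : Hom (D \ox X) \1, ev != 0) \/ (is_zero D /\ is_zero X).
Proof.
move=> [ev [coev [zigzagX zigzagD]]].
have [ev0 | ev_neq0] := eqVneq ev 0; last by left; exists ev.
right; split; apply/is_zeroE.
  apply: (iso_epi (runit_iso M D)).
  by rewrite comp0l comp1m -zigzagD ev0 tens0l comp0r !comp0l.
apply: (iso_epi (lunit_iso M X)).
by rewrite comp0l comp1m -zigzagX ev0 tens0r comp0r !comp0l.
Qed.

Lemma coev_neq0 D X (ev : Hom (D \ox X) \1) (coev : Hom \1 (X \ox D)) :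
  runit M X \after (idm X \oxm ev) \after assoc M X D X \after (coev \oxm idm X)
    = lunit M X ->
  ~ is_zero X -> coev != 0.
Proof.
move=> zigzag X_neq0; apply/eqP => coev0; apply/X_neq0/is_zeroE.
apply: (iso_epi (lunit_iso M X)).
by rewrite comp0l comp1m -zigzag coev0 tens0l comp0r.
Qed.

(** * Simplicity of the unit object *)

Section Unit.
Hypotheses (C_abelian : abelian_category C) (C_rigid : rigid M).
Hypothesis unit_scalar : scalar_unit_endomorphisms M.

Lemma unit_endo_section (e : Hom \1 \1) : e != 0 -> exists h, e \after h = idm \1.
Proof.
have [phi [[psi phiK psiK] phi1 phiM]] := unit_scalar.
rewrite -[e]psiK => phi_neq0; exists (phi (psi e)^-1).
rewrite -phiM divff //; apply: contraNneq phi_neq0 => ->.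
by rewrite linear0.
Qed.

Lemma unit_neq0 : ~ is_zero \1.
Proof.
have [phi [phi_bij phi1 _]] := unit_scalar.
move=> /is_zeroE; rewrite -phi1 -[RHS](linear0 phi) => /(bij_inj phi_bij)/eqP.
by rewrite oner_eq0.
Qed.

(** The epimorphism is the dual of [i], under the identification of the dual
    of the unit with the unit.  If [t] kills it, then, [i] remaining a
    monomorphism after tensoring with [T], the morphism [t] tensored with [U]
    kills the coevaluation; by the zigzag identity, [t] is zero. *)
Lemma subunit_dual_epi D U (i : Hom U \1) (ev : Hom (D \ox U) \1)
    (coev : Hom \1 (U \ox D)) :
  lunit M D \after (ev \oxm idm D) \after associnv M D U D \after (idm D \oxm coev)
    = runit M D ->
  mono i -> epi (lunit M D \after ((i \oxm idm D) \after coev)).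
Proof.
move=> zigzag i_mono; apply/epi_eq0 => T t; rewrite compA -lunit_natural -compA.
rewrite (comp_tail (esym (tens_interchange _ _))) -compA => it0.
have [_ [T' T_dual]] := C_rigid T.
have t_coev0 : (idm U \oxm t) \after coev = 0.
  apply: (left_dual_tensr_mono T_dual i_mono); rewrite comp0r.
  by apply: (iso_mono (lunit_iso M T)); rewrite comp0r.
apply: (iso_epi (runit_iso M D)); rewrite comp0l -zigzag -!compA.
rewrite (comp_tail (esym (lunit_natural _ _))) -compA.
rewrite (comp_tail (esym (tens_interchange _ _))) -compA.
suff -> : idm (D \ox U) \oxm t \after (associnv M D U D \after (idm D \oxm coev)) = 0.
  by rewrite !comp0r.
apply: (iso_mono (assoc_iso D U T)); rewrite -tensm_id.
rewrite (comp_tail (assoc_natural _ _ _ _)) -compA (comp_tail (associnvK _ _ _ _)).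
by rewrite comp1m -tensl_comp t_coev0 tens0r comp0r.
Qed.

(** The dual of [i] is an epimorphism from the unit to the dual [D] of [U], so
    that [U \ox D] is a nonzero quotient of the simple object [U], hence
    isomorphic to it; the coevaluation becomes a nonzero morphism from the unit
    to [U].  Its composite with [i] is a nonzero scalar, which splits [i]. *)
Lemma simple_subunit_iso U (i : Hom U \1) : simple U -> mono i -> is_iso i.
Proof.
move=> U_simple i_mono.
have [[D [ev [coev [zigzagU zigzagD]]]] [D' U_dual]] := C_rigid U.
have /eqP coev0 := coev_neq0 zigzagU (proj1 U_simple).
have [r [rK Kr]] := runit_iso M U.
set d := lunit M D \after ((i \oxm idm D) \after coev).
have dU_epi : epi (idm U \oxm d).
  exact: left_dual_tensl_epi U_dual (subunit_dual_epi zigzagD i_mono).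
set q := (idm U \oxm d) \after r.
have q_epi : epi q by apply: epi_comp dU_epi _; apply: iso_epi; exists (runit M U).
have q_neq0 : q != 0.
  apply/eqP => q0; apply: coev0; rewrite -[coev]comp1m.
  suff -> : idm (U \ox D) = 0 by rewrite comp0l.
  by apply: q_epi; rewrite q0 !comp0r.
have [p [_ qp]] : is_iso q.
  by apply: mono_epi_iso q_epi => //; exact: simple_mono q_neq0.
have [|h igh] := @unit_endo_section (i \after (p \after coev)).
  apply/eqP => ig0; apply: coev0; rewrite -[coev]comp1m -qp -compA.
  suff -> : p \after coev = 0 by rewrite comp0r.
  by apply: i_mono; rewrite ig0 comp0r.
by apply: (mono_section_iso (s := p \after coev \after h)); rewrite // compA.
Qed.

(** A nonzero subobject of the unit contains a simple one, which is the whole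
    unit. *)
Lemma unit_simple : (forall X, finite_length X) -> simple \1.
Proof.
move=> C_length; split=> [|Y j j_mono]; first exact: unit_neq0.
have [|[S [m [S_simple m_mono]]]] := finite_length_simple_sub (C_length Y).
  by left.
right; have [s [_ jms]] := simple_subunit_iso S_simple (mono_comp j_mono m_mono).
by apply: (mono_section_iso (s := m \after s)); rewrite // compA.
Qed.

End Unit.
End Bilinear.
End MonoidalCategory.

(** * Serre tensor ideals *)

Section FiniteTensorCategory.
Variables (k : fieldType) (C : linear_category k) (M : monoidal C).
Hypothesis C_finite_tensor : finite_tensor_category M.

Lemma finite_tensor_unit_simple : simple (unit_obj M).
Proof.
have [[C_abelian C_rigid C_bilin C_scalar] [C_length _]] := C_finite_tensor.
exact: unit_simple.
Qed.

Lemma serre_zero (I : C -> Prop) X : serre_subcategory I -> is_zero X -> I X.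
Proof.
move=> [[Y IY] I_sub _ _] [X0 X0']; apply: (I_sub _ _ (0 : Hom X Y)) IY.
by apply/mono_eq0 => T u _; exact: X0'.
Qed.

(** The unit being simple, a nonzero [ev] makes it a quotient of [P], so that it
    belongs to [I] along with [P].  The parts of the argument that depend on the
    side of the ideal, namely the choice of the pairing [ev] and the passage
    from the unit to all objects, are hypotheses. *)
Lemma serre_trivial (I : C -> Prop) :
  serre_subcategory I ->
  (forall X, I X -> is_zero X \/
     exists (P : C) (ev : Hom P (unit_obj M)), I P /\ ev != 0) ->
  (I (unit_obj M) -> forall X, I X) ->
  trivial_subcategory I.
Proof.
have [[C_abelian _ _ _] _] := C_finite_tensor.
move=> I_serre I_pairing I_unit; have [I1 | nI1] := classic (I (unit_obj M)).
  by right; exact: I_unit.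
left=> X; split; last exact: serre_zero.
move=> /I_pairing[// | [P [ev [IP ev_neq0]]]]; case: nI1.
case: I_serre => _ _ I_quo _; apply: I_quo IP.
exact: (simple_epi C_abelian finite_tensor_unit_simple ev_neq0).
Qed.

Lemma left_serre_tensor_ideal_trivial (I : C -> Prop) :
  left_serre_tensor_ideal M I -> trivial_subcategory I.
Proof.
have [[_ C_rigid C_bilin _] _] := C_finite_tensor.
move=> [I_serre I_ideal]; apply: (serre_trivial I_serre) => [X IX | I1 X].
  have [[D X_dual] _] := C_rigid X.
  have [[ev ev_neq0] | [_ X0]] := left_dual_ev C_bilin X_dual; last by left.
  by right; exists (tens M D X), ev; split=> //; exact: I_ideal.
case: I_serre => _ _ I_quo _.
exact: (I_quo _ _ _ (iso_epi (runit_iso M X)) (I_ideal _ X I1)).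
Qed.

Lemma right_serre_tensor_ideal_trivial (I : C -> Prop) :
  right_serre_tensor_ideal M I -> trivial_subcategory I.
Proof.
have [[_ C_rigid C_bilin _] _] := C_finite_tensor.
move=> [I_serre I_ideal]; apply: (serre_trivial I_serre) => [X IX | I1 X].
  have [_ [D X_dual]] := C_rigid X.
  have [[ev ev_neq0] | [X0 _]] := left_dual_ev C_bilin X_dual; last by left.
  by right; exists (tens M X D), ev; split=> //; exact: I_ideal.
case: I_serre => _ _ I_quo _.
exact: (I_quo _ _ _ (iso_epi (lunit_iso M X)) (I_ideal _ X I1)).
Qed.

(** If [X] is nonzero, the unit embeds in [E \ox X] for a dual [E] of [X], as it
    is simple; tensoring with [X] embeds [X] in [E \ox (X \ox X)]. *)
Lemma finite_tensor_reduced : tensor_reduced M.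
Proof.
have [[C_abelian C_rigid C_bilin _] _] := C_finite_tensor.
move=> X; split=> [XX0 | X0]; last exact: tens_is_zerol.
have [_ [E [ev [coev [zigzagE zigzagX]]]]] := C_rigid X.
have [_ [D X_dual]] := C_rigid X.
have [idX0 | idX_neq0] := eqVneq (idm X) 0; first exact/is_zeroE.
have coev_mono : mono coev.
  apply: (simple_mono C_abelian finite_tensor_unit_simple).
  apply: contra_neq idX_neq0 => coev0; apply: (iso_epi (runit_iso M X)).
  by rewrite comp0l comp1m -zigzagX coev0 tens0r // comp0r.
have EXX0 : is_zero (tens M (tens M E X) X).
  exact: mono_is_zero (iso_mono (assoc_iso _ _ _ _)) (tens_is_zeror C_bilin E XX0).
have [l [lK Kl]] := lunit_iso M X.
have l_mono : mono l by apply: iso_mono; exists (lunit M X).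
exact: mono_is_zero (mono_comp (left_dual_tensr_mono C_bilin X_dual coev_mono) l_mono) EXX0.
Qed.

End FiniteTensorCategory.

Theorem proposition3p11 (k : closedFieldType) (A : linear_category k)
    (M : monoidal A) (hA : finite_tensor_category M) :
  [/\ forall I : A -> Prop, left_serre_tensor_ideal M I -> trivial_subcategory I,
      forall I : A -> Prop, right_serre_tensor_ideal M I -> trivial_subcategory I
    & tensor_reduced M].
Proof.
split; [exact: left_serre_tensor_ideal_trivial
  | exact: right_serre_tensor_ideal_trivial | exact: finite_tensor_reduced].
Qed.
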